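(* Let $Q$ be a differentially closed quasifield. Let $\varphi\colon X\to Y$ be a regular mapping of quasivarieties over $Q$ with dense image, where $Y$ is irreducible. Then the image of $\varphi$ is a big enough subset of $Y$, i.e. it contains the intersection of some countable family of dense open subsets of $Y$.
   Context: A differential ring is a commutative associative unital ring with a fixed finite nonempty set $\Delta$ of pairwise commuting derivations (the same $\Delta$ for all rings). $\Theta$ is the free commutative monoid generated by $\Delta$, acting as derivative operators. All rings have nonzero characteristic. A quasifield is a nonzero differential ring of nonzero characteristic whose only differential ideals are $0$ and the whole ring. $Q\{y_1,\ldots,y_n\}$ is the polynomial ring over $Q$ in the $\theta y_i$ ($\theta\in\Theta$, $1\le i\le n$) with the obvious derivations. For $E\subseteq Q\{y_1,\ldots,y_n\}$, $V(E)\subseteq Q^n$ is the set of common zeros of $E$; for $X\subseteq Q^n$, $I(X)$ is the set of differential polynomials vanishing on $X$. For a differential ideal $\mathfrak a$, $\mathfrak{rad}(\mathfrak a)=\{f\mid\theta f\text{ is nilpotent modulo }\mathfrak a\text{ for all }\theta\in\Theta\}$. $Q$ is differentially closed if $\mathfrak{rad}(\mathfrak a)=I(V(\mathfrak a))$ for every $n$ and every differential ideal $\mathfrak a$ of $Q\{y_1,\ldots,y_n\}$. A quasivariety in $Q^n$ is a subset of the form $V(E)$. The sets $V(E)$ are the closed sets of a topology on $Q^n$, and quasivarieties carry the subspace topology. Irreducible is meant in the topological sense (nonempty, and not the union of two proper closed subsets). For quasivarieties $X\subseteq Q^n$, $Y\subseteq Q^m$, a mapping $\varphi\colon X\to Y$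 is regular if there are differential polynomials $\varphi_1,\ldots,\varphi_m\in Q\{x_1,\ldots,x_n\}$ with $\varphi(x)=(\varphi_1(x),\ldots,\varphi_m(x))$ for all $x\in X$. *)

(* Defs.v *)
From HB Require Import structures.
From mathcomp Require Import all_boot all_order all_algebra.
From mathcomp Require Import finmap monalg.
From mathcomp Require Import boolp classical_sets functions cardinality.
From mathcomp Require Import topology_structure initial_topology subtype_topology.

Set Implicit Arguments.
Unset Strict Implicit.
Unset Printing Implicit Defensive.

Import GRing.Theory.

Local Open Scope classical_set_scope.
Local Open Scope ring_scope.

(* Differential rings are taken nontrivial (comNzRingType): quasifields are
   nonzero by definition, and so are differential polynomials over them. *)
HB.mixin Record ComNzRing_isDifferential (Delta : finType) R
    of GRing.ComNzRing R := {
  der : Delta -> R -> R;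
  derD : forall d, {morph der d : x y / x + y};
  derM : forall d x y, der d (x * y) = der d x * y + x * der d y;
  derC : forall d e x, der d (der e x) = der e (der d x)
}.

#[short(type="diffRingType")]
HB.structure Definition DiffRing (Delta : finType) :=
  { R of GRing.ComNzRing R & ComNzRing_isDifferential Delta R }.

(* Theta, the free commutative monoid on Delta, is {cmonom Delta}: the monomial
   theta stands for the composite of the [iter (theta d) (der d)], whose order
   is irrelevant by [derC]. *)
Definition derop (Delta : finType) (R : diffRingType Delta)
    (theta : {cmonom Delta}) (x : R) : R :=
  foldr (fun d => iter (theta d) (der d)) x (enum Delta).

Section DiffRingTheory.
Context (Delta : finType) (R : diffRingType Delta).
Implicit Types (d e : Delta) (theta : {cmonom Delta}) (x y : R).

Lemma der0 d : der d 0 = 0 :> R.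
Proof. by apply: (addrI (der d 0)); rewrite -derD !addr0. Qed.

Lemma derN d x : der d (- x) = - der d x.
Proof. by apply: (addrI (der d x)); rewrite -derD !subrr der0. Qed.

Lemma der_is_zmod_morphism d : {morph (der d : R -> R) : x y / x - y}.
Proof. by move=> x y; rewrite derD derN. Qed.

HB.instance Definition _ d :=
  GRing.isZmodMorphism.Build R R (der d) (der_is_zmod_morphism d).

Lemma der1 d : der d 1 = 0 :> R.
Proof.
by apply: (addrI (der d 1)); rewrite addr0 -[in RHS](mulr1 1) derM !mulr1 mul1r.
Qed.

Lemma derop1 x : derop mone x = x.
Proof. by rewrite /derop; elim: (enum Delta) => //= d s ->; rewrite cm1. Qed.

Lemma derop0 theta : derop theta 0 = 0 :> R.
Proof.
rewrite /derop; elim: (enum Delta) => //= d s ->.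
by elim: (theta d) => //= k ->; rewrite der0.
Qed.

Lemma der_iter d e k x : der d (iter k (der e) x) = iter k (der e) (der d x).
Proof. by elim: k => //= k IH; rewrite derC IH. Qed.

Lemma deropU d theta x : derop (mmul (ucm d) theta) x = der d (derop theta x).
Proof.
rewrite /derop; have: d \in enum Delta by rewrite mem_enum.
have: uniq (enum Delta) by exact: enum_uniq.
elim: (enum Delta) => //= e s IH /andP[es us]; rewrite cmM cmU inE.
have [ed|ned] /= := eqVneq d e; last first.
  by rewrite add0n => /(IH us) ->; rewrite der_iter.
rewrite -{}ed in es * => _; congr (der _ (iter _ _ _)).
elim: s es {IH us} => //= f s IH; rewrite inE negb_or => /andP[df /IH->].
by rewrite cmM cmU (negbTE df).
Qed.

End DiffRingTheory.

Definition diff_ideal (Delta : finType) (R : diffRingType Delta)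
    (J : set R) : Prop :=
  [/\ J 0,
      forall x y, J x -> J y -> J (x + y),
      forall a x, J x -> J (a * x) &
      forall d x, J x -> J (der d x)].

Definition diff_rad (Delta : finType) (R : diffRingType Delta)
    (J : set R) : set R :=
  [set f | forall theta, exists k, J (derop theta f ^+ k)].

(* The characteristic is nonzero iff some positive integer vanishes. *)
HB.mixin Record DiffRing_isQuasifield (Delta : finType) R
    of DiffRing Delta R := {
  nonzero_char : exists2 p : nat, (0 < p)%N & p%:R = 0 :> R;
  diff_simple : forall J : set R, diff_ideal J -> J = [set 0] \/ J = setT
}.

#[short(type="quasifieldType")]
HB.structure Definition Quasifield (Delta : finType) :=
  { R of DiffRing Delta R & DiffRing_isQuasifield Delta R }.

(* The pair (i, theta) stands for the indeterminate theta y_i. *)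
Definition dvar (Delta : finType) (n : nat) : choiceType :=
  ('I_n * {cmonom Delta})%type.

Definition dpoly (Delta : finType) (R : diffRingType Delta) (n : nat) :=
  {malg R[{cmonom (dvar Delta n)}]}.

Notation "{ 'dpoly' R [ n ] }" := (@dpoly _ R n)
  (at level 0, R, n at level 2, format "{ 'dpoly'  R [ n ] }") : type_scope.

HB.instance Definition _ Delta (R : diffRingType Delta) n :=
  GRing.ComAlgebra.on {dpoly R[n]}.

(* Extends D : R -> R to R[K] with h k as the derivative of the monomial k. *)
Section MalgDer.
Context (K : conomType) (R : comNzRingType).
Implicit Types (D : R -> R) (h : K -> {malg R[K]}) (f g : {malg R[K]}).

Definition malg_der D h f : {malg R[K]} :=
  \sum_(k <- msupp f) (<< D (f@_k) *g k >> + f@_k *: h k).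

Lemma malgUU (c1 c2 : R) (k1 k2 : K) :
  << c1 *g k1 >> * << c2 *g k2 >> = << c1 * c2 *g mmul k1 k2 >> :> {malg R[K]}.
Proof. by rewrite malgM_def fgmulUU. Qed.

Lemma malgZU (c1 c2 : R) (k : K) :
  c1 *: << c2 *g k >> = << c1 * c2 *g k >> :> {malg R[K]}.
Proof. by apply/malgP => l; rewrite mcoeffZ !mcoeffU mulrnAr. Qed.

Lemma malgUE (c : R) (k : K) : << c *g k >> = c%:MP * << k >> :> {malg R[K]}.
Proof. by rewrite malgUU mulr1 mul1m. Qed.

Lemma malg_leibniz (T : Type) (A : seq T) (c c1 c2 : T -> nat) (a1 a2 b : T -> K)
    (k1 k2 : K) :
  (forall v, c v = c1 v + c2 v)%N ->
  (forall v, c1 v != 0%N -> b v = mmul (a1 v) k2) ->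
  (forall v, c2 v != 0%N -> b v = mmul k1 (a2 v)) ->
  \sum_(v <- A) << (c v)%:R *g b v >> =
  (\sum_(v <- A) << (c1 v)%:R *g a1 v >>) * << k2 >>
  + << k1 >> * (\sum_(v <- A) << (c2 v)%:R *g a2 v >>) :> {malg R[K]}.
Proof.
move=> h0 h1 h2; rewrite mulr_suml mulr_sumr -big_split /=; apply: eq_bigr => v _.
rewrite h0 !malgUU mulr1 mul1r natrD monalgUD; congr (_ + _).
  by have [->|/h1->//] := eqVneq (c1 v) 0%N; rewrite !monalgU0.
by have [->|/h2->//] := eqVneq (c2 v) 0%N; rewrite !monalgU0.
Qed.

Context (D : {additive R -> R}) (h : K -> {malg R[K]}).

Lemma malg_derE f :
  malg_der D h f = mmap (malgC \o D) (fun k => << k >> : {malg R[K]}) f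
                   + mmap (@malgC K R) h f.
Proof.
rewrite /mmap -big_split /=; apply: eq_bigr => k _.
by rewrite -malgUE mul_malgC.
Qed.

Lemma malg_der_is_zmod_morphism : {morph malg_der D h : f g / f - g}.
Proof.
move=> f g; rewrite !malg_derE.
rewrite (raddfB (mmap (malgC \o D : {additive R -> {malg R[K]}}) _)).
by rewrite (raddfB (mmap _ h)) opprD addrACA.
Qed.

HB.instance Definition _ := GRing.isZmodMorphism.Build {malg R[K]} {malg R[K]}
  (malg_der D h) malg_der_is_zmod_morphism.

Lemma malg_derD : {morph malg_der D h : f g / f + g}.
Proof. exact: raddfD. Qed.

Lemma malg_derU c k : malg_der D h << c *g k >> = << D c *g k >> + c *: h k.
Proof.
rewrite malg_derE.
rewrite (@mmapU _ _ _ (malgC \o D : {additive R -> {malg R[K]}})).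
rewrite (@mmapU _ _ _ (malgC : {additive R -> {malg R[K]}})) /=.
by rewrite -malgUE mul_malgC.
Qed.

Lemma malg_derU1 k : D 1 = 0 -> malg_der D h << k >> = h k.
Proof. by move=> D1; rewrite malg_derU D1 monalgU0 add0r scale1r. Qed.

Lemma malg_derCst c : h mone = 0 -> malg_der D h c%:MP = (D c)%:MP.
Proof. by move=> h1; rewrite malg_derU h1 scaler0 addr0. Qed.

Lemma malg_derM :
    (forall a b, D (a * b) = D a * b + a * D b) ->
    (forall k l, h (mmul k l) = h k * << l >> + << k >> * h l) ->
  forall f g, malg_der D h (f * g) = malg_der D h f * g + f * malg_der D h g.
Proof.
move=> DM hM f g.
rewrite (monalgE f); elim/big_ind: _ => [|f1 f2 IH1 IH2|k _].
- by rewrite !(mul0r, raddf0) addr0.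
- by rewrite mulrDl !malg_derD IH1 IH2 !mulrDl addrACA.
rewrite (monalgE g); elim/big_ind: _ => [|g1 g2 IH1 IH2|l _].
- by rewrite !(mulr0, raddf0) addr0.
- by rewrite mulrDr !malg_derD IH1 IH2 !mulrDr addrACA.
move: (f@_k) (g@_l) => a b; rewrite malgUU !malg_derU hM DM.
rewrite monalgUD mulrDl mulrDr !malgUU -!addrA; congr (_ + _).
rewrite addrCA; congr (_ + _); rewrite scalerDr; congr (_ + _).
  rewrite (_ : << b *g l >> = b *: << l >>); last by rewrite malgZU mulr1.
  by rewrite -scalerAl -scalerAr scalerA.
rewrite (_ : << a *g k >> = a *: << k >>); last by rewrite malgZU mulr1.
by rewrite -scalerAl -scalerAr scalerA.
Qed.

End MalgDer.

Lemma cmonom_ind (I : choiceType) (P : {cmonom I} -> Prop) :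
  P mone -> (forall i m, P m -> P (mmul (ucm i) m)) -> forall m, P m.
Proof.
move=> P1 PU m; have [k] := ubnP (mdeg m); elim: k m => // k IH m.
rewrite ltnS => le_mk; have [->|/eqP m1] := eqVneq m mone; first exact: P1.
have [i mi] : exists i, m i != 0%N.
  apply: contrapT => ni; apply: m1; apply/eqP/cmP => i; rewrite cm1.
  by apply/eqP/negP => /negP mi; apply: ni; exists i.
have em : m = mmul (ucm i) (divcm m (ucm i)).
  apply/eqP/cmP => j; rewrite cmM divcmE cmU.
  have [<-|_] := eqVneq i j; last by rewrite subn0.
  by rewrite subnKC // lt0n.
rewrite em; apply: PU; apply: IH.
by move: le_mk; rewrite {1}em mdegM mdegU add1n.
Qed.

Lemma malg_cmonom_ind (I : choiceType) (R : comNzRingType)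
    (P : {malg R[{cmonom I}]} -> Prop) :
  (forall c, P c%:MP) -> (forall i, P << ucm i >>) ->
  (forall f g, P f -> P g -> P (f + g)) ->
  (forall f g, P f -> P g -> P (f * g)) -> forall f, P f.
Proof.
move=> PC PU PD PM f; rewrite (monalgE f); apply: big_ind => //.
  by rewrite -malgC0E.
move=> m _; rewrite malgUE; apply: (PM) => //.
elim/cmonom_ind: m => [|i m Pm]; first exact: PC.
have := PM _ _ (PU i) Pm.
by rewrite malgUU mulr1.
Qed.

(* The Leibniz rule on a monomial m in the variables I, where the derivative of
   the variable v is the variable s v; divcm m (ucm v) is m / v. *)
Definition cmonom_der (I : choiceType) (R : comNzRingType) (s : I -> I)
    (m : {cmonom I}) : {malg R[{cmonom I}]} :=
  \sum_(v <- finsupp m) << (m v)%:R *g mmul (divcm m (ucm v)) (ucm (s v)) >>.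

Section CmonomDer.
Context (I : choiceType) (R : comNzRingType) (s : I -> I).
Local Notation dm := (@cmonom_der I R s).

Lemma cmonom_derE (m : {cmonom I}) (A : {fset I}) : (finsupp m `<=` A)%fset ->
  dm m = \sum_(v <- A) << (m v)%:R *g mmul (divcm m (ucm v)) (ucm (s v)) >>.
Proof.
move=> sA; rewrite /cmonom_der; apply: big_fset_incl => // v _.
by rewrite -cmE_eq0 => /eqP->; rewrite monalgU0.
Qed.

Lemma cmonom_derM m1 m2 :
  dm (mmul m1 m2) = dm m1 * << m2 >> + << m1 >> * dm m2.
Proof.
rewrite (@cmonom_derE _ (finsupp m1 `|` finsupp m2)%fset) ?mdomD //.
rewrite (@cmonom_derE m1 (finsupp m1 `|` finsupp m2)%fset) ?fsubsetUl //.
rewrite (@cmonom_derE m2 (finsupp m1 `|` finsupp m2)%fset) ?fsubsetUr //.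
apply: malg_leibniz => [v|v mv|v mv]; first exact: cmM.
  apply/eqP/cmP => w; rewrite !(cmM, divcmE, cmU).
  have [<-|_] := eqVneq v w; last by rewrite !subn0 addnAC.
  by rewrite -addnBAC ?lt0n // addnAC.
apply/eqP/cmP => w; rewrite !(cmM, divcmE, cmU).
have [<-|_] := eqVneq v w; last by rewrite !subn0 addnA.
by rewrite -addnBA ?lt0n // addnA.
Qed.

Lemma cmonom_der1 : dm mone = 0.
Proof. by rewrite /cmonom_der mdom1 big_seq_fset0. Qed.

Lemma cmonom_derX v : dm (ucm v) = << ucm (s v) >>.
Proof.
have e : mmul (divcm (ucm v) (ucm v)) (ucm (s v)) = ucm (s v).
  by apply/eqP/cmP => w; rewrite cmM divcmE subnn.
by rewrite /cmonom_der mdomU big_seq_fset1 cmUU e.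
Qed.

End CmonomDer.

Section DerComm.
Context (A : comNzRingType) (F G : A -> A).
Hypotheses (FD : {morph F : x y / x + y}) (GD : {morph G : x y / x + y}).
Hypotheses (FM : forall x y, F (x * y) = F x * y + x * F y).
Hypotheses (GM : forall x y, G (x * y) = G x * y + x * G y).

Lemma der_commD x y :
  F (G x) = G (F x) -> F (G y) = G (F y) -> F (G (x + y)) = G (F (x + y)).
Proof. by move=> hx hy; rewrite FD !GD FD hx hy. Qed.

Lemma der_commM x y :
  F (G x) = G (F x) -> F (G y) = G (F y) -> F (G (x * y)) = G (F (x * y)).
Proof.
move=> hx hy; rewrite FM !GM FD GD !FM !GM hx hy -!addrA; congr (_ + _).
by rewrite addrCA.
Qed.

End DerComm.

(* Locked, as unifying two distinct monomials of R[{cmonom I}] is costly. *)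
HB.lock Definition dpolyC (Delta : finType) (R : diffRingType Delta) (n : nat)
  (c : R) : {dpoly R[n]} := c%:MP.
HB.lock Definition dpolyX (Delta : finType) (R : diffRingType Delta) (n : nat)
  (v : dvar Delta n) : {dpoly R[n]} := << ucm v >>.
Arguments dpolyC {Delta R n} c.
Arguments dpolyX {Delta R n} v.

Section DPolyDer.
Context (Delta : finType) (R : diffRingType Delta) (n : nat).
Implicit Types (d e : Delta) (v : dvar Delta n) (f g : {dpoly R[n]}).

Definition dvar_der d v : dvar Delta n := (v.1, mmul (ucm d) v.2).

Definition dpoly_der d : {dpoly R[n]} -> {dpoly R[n]} :=
  malg_der (der d) (cmonom_der R (dvar_der d)).

Lemma dpoly_derD d : {morph dpoly_der d : f g / f + g}.
Proof. exact: malg_derD. Qed.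

Lemma dpoly_derM d f g :
  dpoly_der d (f * g) = dpoly_der d f * g + f * dpoly_der d g.
Proof. exact: (@malg_derM _ _ (der d : {additive R -> R}) _ (derM d)
  (cmonom_derM R (dvar_der d))). Qed.

Lemma dpoly_ind (P : {dpoly R[n]} -> Prop) :
  (forall c, P (dpolyC c)) -> (forall v, P (dpolyX v)) ->
  (forall f g, P f -> P g -> P (f + g)) ->
  (forall f g, P f -> P g -> P (f * g)) -> forall f, P f.
Proof. rewrite dpolyC.unlock dpolyX.unlock; exact: malg_cmonom_ind. Qed.

Lemma dpoly_derCst d (c : R) : dpoly_der d (dpolyC c) = dpolyC (der d c).
Proof.
rewrite dpolyC.unlock.
exact: (@malg_derCst _ _ (der d : {additive R -> R}) (cmonom_der R (dvar_der d)) c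
  (cmonom_der1 _ _)).
Qed.

Lemma dpoly_derX d v : dpoly_der d (dpolyX v) = dpolyX (dvar_der d v).
Proof.
rewrite dpolyX.unlock.
have e := @malg_derU1 _ _ (der d : {additive R -> R})
  (cmonom_der R (dvar_der d)) (ucm v) (der1 R d).
by rewrite cmonom_derX in e; exact: e.
Qed.

Lemma dpoly_derC d e f :
  dpoly_der d (dpoly_der e f) = dpoly_der e (dpoly_der d f).
Proof.
elim/dpoly_ind: f => [c|v|f g IHf IHg|f g IHf IHg].
- by rewrite !dpoly_derCst derC.
- by rewrite !dpoly_derX /dvar_der /= mulmA (mulmC (ucm d)) -mulmA.
- exact: (der_commD (dpoly_derD d) (dpoly_derD e) IHf IHg).
exact: (der_commM (dpoly_derD d) (dpoly_derD e) (dpoly_derM d) (dpoly_derM e)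
  IHf IHg).
Qed.

HB.instance Definition _ := ComNzRing_isDifferential.Build Delta {dpoly R[n]}
  dpoly_derD dpoly_derM dpoly_derC.

Lemma dpoly_dCst d (c : R) : der d (dpolyC c) = dpolyC (der d c).
Proof. exact: dpoly_derCst. Qed.

Lemma dpoly_dX d v : der d (dpolyX v) = dpolyX (dvar_der d v).
Proof. exact: dpoly_derX. Qed.

End DPolyDer.

Definition cmonom_eval (I : choiceType) (S : comNzRingType) (w : I -> S)
    (m : {cmonom I}) : S :=
  \prod_(v <- finsupp m) w v ^+ m v.

Section CmonomEval.
Context (I : choiceType) (S : comNzRingType) (w : I -> S).

Lemma cmonom_evalE (m : {cmonom I}) (A : {fset I}) : (finsupp m `<=` A)%fset ->
  cmonom_eval w m = \prod_(v <- A) w v ^+ m v.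
Proof.
move=> sA; rewrite /cmonom_eval; apply: big_fset_incl => // v _.
by rewrite -cmE_eq0 => /eqP->; rewrite expr0.
Qed.

Lemma cmonom_eval_mmorphism : mmorphism (cmonom_eval w).
Proof.
split=> [m1 m2|]; last by rewrite /cmonom_eval mdom1 big_seq_fset0.
rewrite (@cmonom_evalE _ (finsupp m1 `|` finsupp m2)%fset) ?mdomD //.
rewrite (@cmonom_evalE m1 (finsupp m1 `|` finsupp m2)%fset) ?fsubsetUl //.
rewrite (@cmonom_evalE m2 (finsupp m1 `|` finsupp m2)%fset) ?fsubsetUr //.
by rewrite -big_split /=; apply: eq_bigr => v _; rewrite cmM exprD.
Qed.

HB.instance Definition _ :=
  isMultiplicative.Build {cmonom I} S (cmonom_eval w) cmonom_eval_mmorphism.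

Lemma cmonom_evalX v : cmonom_eval w (ucm v) = w v.
Proof. by rewrite /cmonom_eval mdomU big_seq_fset1 cmUU. Qed.

End CmonomEval.

(* The value at x, obtained by substituting theta (x_i) for theta y_i. *)
Definition deval (Delta : finType) (R : diffRingType Delta) (n : nat)
    (x : {ffun 'I_n -> R}) (f : {dpoly R[n]}) : R :=
  mmap idfun (cmonom_eval (fun v : dvar Delta n => derop v.2 (x v.1))) f.

Section DerHom.
Context (A B : comNzRingType) (F : A -> A) (G : B -> B) (u : A -> B).
Hypotheses (uD : {morph u : x y / x + y}) (uM : {morph u : x y / x * y}).
Hypotheses (FD : {morph F : x y / x + y}) (GD : {morph G : x y / x + y}).
Hypotheses (FM : forall x y, F (x * y) = F x * y + x * F y).
Hypotheses (GM : forall x y, G (x * y) = G x * y + x * G y).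

Lemma der_homD x y :
  u (F x) = G (u x) -> u (F y) = G (u y) -> u (F (x + y)) = G (u (x + y)).
Proof. by move=> hx hy; rewrite FD !uD GD hx hy. Qed.

Lemma der_homM x y :
  u (F x) = G (u x) -> u (F y) = G (u y) -> u (F (x * y)) = G (u (x * y)).
Proof. by move=> hx hy; rewrite FM uD !uM GM hx hy. Qed.

End DerHom.

Section DEval.
Context (Delta : finType) (R : diffRingType Delta) (n : nat).
Context (x : {ffun 'I_n -> R}).
Implicit Types (d : Delta) (v : dvar Delta n) (f g : {dpoly R[n]}).

Lemma deval_is_zmod_morphism : {morph deval x : f g / f - g}.
Proof.
exact: (raddfB (mmap (idfun : {additive R -> R})
  (cmonom_eval (fun v : dvar Delta n => derop v.2 (x v.1))))).
Qed.

HB.instance Definition _ :=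
  GRing.isZmodMorphism.Build {dpoly R[n]} R (deval x) deval_is_zmod_morphism.

Lemma deval_is_monoid_morphism : monoid_morphism (deval x).
Proof.
have [eM e1] := @mmap_is_multiplicative {cmonom (dvar Delta n)} R R idfun
  (cmonom_eval (fun v : dvar Delta n => derop v.2 (x v.1))).
by split.
Qed.

HB.instance Definition _ :=
  GRing.isMonoidMorphism.Build {dpoly R[n]} R (deval x) deval_is_monoid_morphism.

Lemma devalD : {morph deval x : f g / f + g}.
Proof. exact: raddfD. Qed.

Lemma devalM : {morph deval x : f g / f * g}.
Proof. exact: rmorphM. Qed.

Lemma devalCst (c : R) : deval x (dpolyC c) = c.
Proof.
rewrite dpolyC.unlock.
exact: (@mmapC {cmonom (dvar Delta n)} R R idfun
  (cmonom_eval (fun v : dvar Delta n => derop v.2 (x v.1)))).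
Qed.

Lemma devalX v : deval x (dpolyX v) = derop v.2 (x v.1).
Proof.
rewrite dpolyX.unlock.
have e := @mmapU {cmonom (dvar Delta n)} R R idfun
  (cmonom_eval (fun v : dvar Delta n => derop v.2 (x v.1))) 1 (ucm v).
by apply: etrans e _; rewrite mul1r cmonom_evalX.
Qed.

Lemma deval_der d f : deval x (der d f) = der d (deval x f).
Proof.
elim/dpoly_ind: f => [c|v|f g IHf IHg|f g IHf IHg].
- by rewrite dpoly_dCst !devalCst.
- by rewrite dpoly_dX !devalX deropU.
- exact (@der_homD {dpoly R[n]} R (der d) (der d) (deval x) (@devalD)
    (derD d) (derD d) f g IHf IHg).
exact (@der_homM {dpoly R[n]} R (der d) (der d) (deval x) (@devalD)
  (@devalM) (derM d) (derM d) f g IHf IHg).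
Qed.

Lemma deval_derop theta f : deval x (derop theta f) = derop theta (deval x f).
Proof.
rewrite /derop; elim: (enum Delta) => //= d s <-.
by elim: (theta d) => //= k <-; exact: deval_der.
Qed.

End DEval.

Definition zeros (Delta : finType) (R : diffRingType Delta) (n : nat)
    (E : set {dpoly R[n]}) : set {ffun 'I_n -> R} :=
  [set x | forall f, E f -> deval x f = 0].

Definition vanishing (Delta : finType) (R : diffRingType Delta) (n : nat)
    (X : set {ffun 'I_n -> R}) : set {dpoly R[n]} :=
  [set f | forall x, X x -> deval x f = 0].

Definition diff_closed (Delta : finType) (Q : quasifieldType Delta) : Prop :=
  forall (n : nat) (J : set {dpoly Q[n]}),
    diff_ideal J -> diff_rad J = vanishing (zeros J).

(* Q^n with the topology whose closed sets are the zero sets. *)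
Definition dspace (Delta : finType) (Q : quasifieldType Delta) (n : nat) : Type :=
  {ffun 'I_n -> Q}.

HB.instance Definition _ Delta (Q : quasifieldType Delta) n :=
  Choice.on (dspace Q n).

Section Zariski.
Context (Delta : finType) (Q : quasifieldType Delta) (n : nat).

Definition zariski_open : set (set (dspace Q n)) :=
  [set U | exists E : set {dpoly Q[n]}, ~` U = zeros E].

(* Q need not be a domain, but a zero product of a with all derivatives of b
   still forces a or b to vanish. *)
Lemma quasifield_derop_eq0 (a b : Q) :
  (forall theta, a * derop theta b = 0) -> a = 0 \/ b = 0.
Proof.
move=> ab; pose J : set Q := [set c | forall theta, c * derop theta b = 0].
have JI : diff_ideal J.
  split=> [theta|c c' Jc Jc' theta|c c' Jc' theta|d c Jc theta].
  - by rewrite mul0r.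
  - by rewrite mulrDl Jc Jc' addr0.
  - by rewrite -mulrA Jc' mulr0.
  have := derM d c (derop theta b).
  by rewrite -deropU !Jc der0 addr0.
have [J0|JT] := diff_simple _ JI.
  by left; have : [set 0] a by rewrite -J0.
right; have : J 1 by rewrite JT.
by move=> /(_ mone); rewrite derop1 mul1r.
Qed.

Lemma zeros_vanishing (E : set {dpoly Q[n]}) : zeros (vanishing (zeros E)) = zeros E.
Proof.
by apply/seteqP; split=> x zx f; [move=> Ef; apply: zx => y; exact | move=> vf; exact: vf].
Qed.

Lemma zariski_openT : zariski_open setT.
Proof.
exists [set 1]; rewrite setCT; apply/esym/seteqP; split=> // x /(_ 1 erefl).
by move=> /eqP; rewrite rmorph1 oner_eq0.
Qed.

Lemma zariski_openI : setI_closed zariski_open.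
Proof.
move=> U V [E UE] [F VF].
exists [set h | exists f g theta, [/\ E f, F g & h = f * derop theta g]].
rewrite setCI UE VF; apply/seteqP; split=> x.
  move=> [Ex|Fx] _ [f [g [theta [Ef Fg ->]]]]; rewrite devalM.
    by rewrite (Ex f Ef) mul0r.
  by rewrite deval_derop (Fx g Fg) derop0 mulr0.
move=> zx; apply: contrapT => /not_orP[/existsNP[f /not_implyP[Ef fx]]].
move=> /existsNP[g /not_implyP[Fg gx]].
case: (@quasifield_derop_eq0 (deval x f) (deval x g)) => // theta.
by rewrite -deval_derop -devalM; apply: zx; exists f, g, theta.
Qed.

Lemma zariski_open_bigU (I : Type) (U : I -> set (dspace Q n)) :
  (forall i, zariski_open (U i)) -> zariski_open (\bigcup_i U i).
Proof.
move=> Uop; exists (\bigcup_i vanishing (~` U i)).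
rewrite setC_bigcup; apply/seteqP; split=> x.
  by move=> Ux f [i _]; apply; exact: Ux.
move=> zx i _; have [E UE] := Uop i; rewrite UE -zeros_vanishing => f vf.
by apply: zx; exists i => //; rewrite UE.
Qed.

HB.instance Definition _ := isOpenTopological.Build (dspace Q n)
  zariski_openT zariski_openI zariski_open_bigU.

End Zariski.

Definition quasivariety (Delta : finType) (Q : quasifieldType Delta) (n : nat)
    (X : set (dspace Q n)) : Prop :=
  exists E : set {dpoly Q[n]}, X = zeros E.

Definition regular_map (Delta : finType) (Q : quasifieldType Delta) (n m : nat)
    (X : set (dspace Q n)) (Y : set (dspace Q m)) (phi : X -> Y) : Prop :=
  exists p : 'I_m -> {dpoly Q[n]},
    forall x : X, set_val (phi x) = [ffun j => deval (set_val x) (p j)].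

Definition irreducible_space (T : topologicalType) : Prop :=
  [set: T] !=set0 /\
  forall A B : set T, closed A -> closed B ->
    A `|` B = [set: T] -> A = [set: T] \/ B = [set: T].

Definition big_enough (T : topologicalType) (A : set T) : Prop :=
  exists F : set (set T),
    [/\ countable F, forall U, F U -> open U /\ dense U &
        \bigcap_(U in F) U `<=` A].

(* Main.v *)
Require Import Defs.
From mathcomp Require Import all_boot all_order all_algebra.
From mathcomp Require Import monalg.
From mathcomp Require Import boolp classical_sets functions cardinality.
From mathcomp Require Import topology_structure initial_topology subtype_topology.

Local Open Scope classical_set_scope.

(** Let p be the characteristic of Q.  The p-th powers of elements of Q are
    constants, so they are zero or not zero divisors, and hence the p-th powers
    of differential polynomial functions on the irreducible Y form a domain
    [B^p].  By the differential Nullstellensatz a point y of Y is outside the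
    image of phi iff 1 = sum_k a_k (u_k o phi) on X for some u_k vanishing at y.
    Raising this to the p-th power, all takes place in the [B^p]-algebra of
    p-th powers of functions on X, which is spanned over [B^p] by countably many
    monomials.  For each finite list of monomials, linear algebra over the
    fraction field of [B^p] yields a single nonzero s in [B^p] that vanishes at
    every y for which such a relation involves only the listed monomials; the
    loci s <> 0 form the countable family. *)

Import GRing.Theory.

(** * Prime characteristic and p-th powers *)

(** Let [q] be the least positive integer that vanishes in Q. The annihilator of the prime [pdiv q]
    is a differential ideal; were it zero, [q %/ pdiv q] would already vanish. *)
Lemma quasifield_pchar (Delta : finType) (Q : quasifieldType Delta) :
  exists p, p \in [pchar Q]%R.
Proof.
have exq : exists q, (0 < q)%N && (q%:R == 0 :> Q)%R.
  by have [q q0 /eqP qQ] := @nonzero_char Delta Q; exists q; rewrite q0.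
have [q /andP[q0 qQ] qmin] := ex_minnP exq.
have q1 : (1 < q)%N.
  by case: q q0 qQ {qmin} => [|[|q]] //; rewrite oner_eq0.
exists (pdiv q); rewrite inE /= pdiv_prime //=.
pose J : set Q := [set a | ((pdiv q)%:R * a = 0)%R].
have JI : diff_ideal J.
  split=> [|a b|a b|d a]; rewrite /J /=.
  - by rewrite mulr0.
  - by rewrite mulrDr => -> ->; rewrite addr0.
  - by move=> h; rewrite mulrCA h mulr0.
  - by rewrite !mulr_natl => h; rewrite -raddfMn h raddf0.
have [J0|JT] := diff_simple _ JI; last first.
  by have : J 1%R by [rewrite JT]; rewrite /J /= mulr1 => ->.
have r0 : (0 < q %/ pdiv q)%N by rewrite divn_gt0 ?pdiv_gt0 // dvdn_leq ?pdiv_dvd.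
have : J (q %/ pdiv q)%:R%R.
  by rewrite /J /= -natrM mulnC divnK ?pdiv_dvd //; exact/eqP.
rewrite J0 /= => r.
have := qmin (q %/ pdiv q)%N; rewrite r0 r eqxx => /(_ isT).
by rewrite leqNgt ltn_Pdiv // prime_gt1 // pdiv_prime.
Qed.

Lemma der_exp (Delta : finType) (R : diffRingType Delta) (d : Delta) (x : R) k :
  (der d (x ^+ k.+1) = (x ^+ k * der d x) *+ k.+1)%R.
Proof.
elim: k => [|k IH]; first by rewrite expr1 expr0 mul1r.
by rewrite exprS derM IH mulrnAr mulrA -exprS mulrC -mulrS.
Qed.

(** In characteristic p the element [a ^+ p] is a constant, so its annihilator is a differential
    ideal. *)
Lemma quasifield_exp_pchar_integral (Delta : finType) (Q : quasifieldType Delta)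
    (p : nat) (a b : Q) : p \in [pchar Q]%R ->
  (a ^+ p * b = 0 -> a ^+ p = 0 \/ b = 0)%R.
Proof.
move=> chp; pose J : set Q := [set c | (a ^+ p * c = 0)%R].
have da d : der d (a ^+ p)%R = 0%R.
  have := pcharf0 chp; have := prime_gt0 (pcharf_prime chp).
  by case: (p) => // k _ k0; rewrite der_exp -mulr_natr k0 mulr0.
have JI : diff_ideal J.
  split=> [|c c'|c c'|d c]; rewrite /J /=.
  - by rewrite mulr0.
  - by rewrite mulrDr => -> ->; rewrite addr0.
  - by move=> h; rewrite mulrCA h mulr0.
  - by move=> h; have := derM d (a ^+ p)%R c; rewrite h da mul0r add0r der0.
move=> Jb; have [J0|JT] := diff_simple _ JI.
  by right; have : J b by []; rewrite J0.
by left; have : J 1%R by [rewrite JT]; rewrite /J /= mulr1.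
Qed.

(** * Linear algebra modulo a prime ideal *)

(* The family rho t makes the functions T -> S a module over R; it is torsion
   free over R / N, where N, the intersection of the kernels, is assumed prime.
   The conclusion says that chi s is the obstruction for 1 to lie in the
   submodule spanned by ker chi times the e w, for w in l. *)
Lemma generic_independence (R S S' : comNzRingType) (T W : Type)
    (rho : T -> {rmorphism R -> S}) (e : W -> T -> S) (l : seq W) :
  let N := [set r : R | forall t, rho t r = 0%R] in
  ~ N 1%R -> (forall r s, N (r * s)%R -> N r \/ N s) ->
  exists2 s, ~ N s & forall chi : {rmorphism R -> S'},
    (forall r, N r -> chi r = 0%R) ->
    forall (L : seq (R * W)) (r : R),
      map snd L = l -> all (fun q => chi q.1 == 0%R) L ->
      (forall t, rho t r = \sum_(q <- L) rho t q.1 * e q.2 t)%R ->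
    chi (s * r)%R = 0%R.
Proof.
move=> N N1 Nprime; elim: l => [|w l [s Ns IH]].
  exists 1%R => // chi chiN [|//] r _ _ h; rewrite mul1r; apply: chiN => t.
  by rewrite h big_nil.
(* Is [e w] dependent on 1 and the [e] of [l] over the fraction field of R / N? If so, multiplying
   by [s'] eliminates [e w] and leaves a relation for [s' * r - a * d] over [l], where [chi] kills
   [a]. *)
have [[s' [Ns' [d [D [Dl hD]]]]]|ndep] := pselect (exists s', ~ N s' /\
    exists d (D : seq (R * W)), map snd D = l /\
    forall t, (rho t s' * e w t = rho t d + \sum_(q <- D) rho t q.1 * e q.2 t)%R).
  exists (s * s')%R; first by move=> /Nprime[].
  move=> chi chiN [|[a w'] L] // r [-> Ll] /andP[/eqP/= a0 L0] h.
  pose L' := [seq (s' * x.1.1 + a * x.2.1, x.1.2)%R | x <- zip L D].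
  have sz : size L = size D by rewrite -(size_map snd L) Ll -Dl size_map.
  have L'l : map snd L' = l.
    by rewrite -map_comp -Ll -[in RHS](unzip1_zip (s := L) (t := D)) ?sz // -map_comp.
  have L'0 : all (fun q => chi q.1 == 0%R) L'.
    rewrite all_map; elim: (L) (D) L0 => [|[b v] M IHM] [|c E] //= /andP[/eqP/= b0 M0].
    by rewrite rmorphD !rmorphM b0 a0 mulr0 mul0r addr0 eqxx IHM.
  have hL' t : (rho t (s' * r - a * d) = \sum_(q <- L') rho t q.1 * e q.2 t)%R.
    have -> : (\sum_(q <- L') rho t q.1 * e q.2 t =
        rho t s' * (\sum_(q <- L) rho t q.1 * e q.2 t) +
        rho t a * (\sum_(q <- D) rho t q.1 * e q.2 t))%R.
      have : map snd L = map snd D by rewrite Ll.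
      rewrite /L' big_map; elim: (L) (D) => [|[b v] M IHM] [|[c v'] E] //=.
        by rewrite !big_nil !mulr0 addr0.
      case=> <- /IHM eM; rewrite !big_cons eM /= rmorphD !rmorphM.
      by rewrite !mulrDr mulrDl !mulrA addrACA.
    have := hD t; have := h t; rewrite big_cons /= rmorphB !rmorphM => ->.
    move=> hw; rewrite mulrDr mulrCA hw mulrDr.
    by rewrite -!addrA addrC -!addrA addNr addr0 addrC.
  have := IH chi chiN L' _ L'l L'0 hL'.
  by rewrite mulrBr rmorphB !rmorphM a0 mul0r mulr0 subr0 mulrA.
exists s => // chi chiN [|[a w'] L] // r [-> Ll] /andP[/eqP/= a0 L0] h.
(* Otherwise the given relation would itself express [a * e w] through 1 and [l]. *)
have Na : N a.
  apply: contrapT => Na; apply: ndep; exists a; split=> //.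
  exists r, [seq (- q.1, q.2)%R | q <- L]; split.
    by rewrite -map_comp -Ll; exact: eq_map.
  move=> t; rewrite h big_cons /= big_map /=.
  under [X in (_ = _ + X)%R]eq_bigr do rewrite rmorphN mulNr.
  by rewrite sumrN addrK.
apply: (IH chi chiN L) => // t.
by rewrite h big_cons /= (Na t) mul0r add0r.
Qed.

(** * A countable spanning family of monomials *)

Section MonomialSpan.
Context (Delta : finType) (R : diffRingType Delta) (n : nat).

(** Words in [Delta] stand for derivative operators so that the indices form a countable type;
    different words may give the same variable. *)
Definition wordX (v : 'I_n * seq Delta) : {dpoly R[n]} :=
  dpolyX (v.1, foldr (fun d m => mmul (ucm d) m) mone v.2).

Lemma dpolyX_word (v : dvar Delta n) : exists w, dpolyX v = wordX w.
Proof.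
case: v => i m; elim/cmonom_ind: m => [|d m [w]]; first by exists (i, [::]).
suff : exists s : seq Delta, m = foldr (fun d m => mmul (ucm d) m) mone s.
  by move=> [s ->] _; exists (i, d :: s).
elim/cmonom_ind: m {w} => [|f m [s ->]]; first by exists [::].
by exists (f :: s).
Qed.

Definition monoX (w : seq ('I_n * seq Delta)) : {dpoly R[n]} :=
  (\prod_(v <- w) wordX v)%R.

Lemma dpoly_monoX_span (f : {dpoly R[n]}) :
  exists L : seq (R * seq ('I_n * seq Delta)),
    f = (\sum_(q <- L) dpolyC q.1 * monoX q.2)%R.
Proof.
have CM (a b : R) : dpolyC (a * b)%R = (dpolyC a * dpolyC b)%R :> {dpoly R[n]}.
  by rewrite dpolyC.unlock; exact: mpolyCM.
have C1 : dpolyC 1%R = 1%R :> {dpoly R[n]} by rewrite dpolyC.unlock.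
elim/dpoly_ind: f => [c|v|f g [L ->] [L' ->]|f g [L ->] [L' ->]].
- by exists [:: (c, [::])]; rewrite big_seq1 /monoX big_nil mulr1.
- have [w ->] := dpolyX_word v; exists [:: (1%R, [:: w])].
  by rewrite big_seq1 /monoX big_seq1 /= C1 mul1r.
- by exists (L ++ L'); rewrite big_cat.
exists [seq ((q.1 * q'.1)%R, q.2 ++ q'.2) | q <- L, q' <- L'].
rewrite big_allpairs_dep mulr_suml; apply: eq_bigr => q _.
rewrite mulr_sumr; apply: eq_bigr => q' _ /=.
by rewrite /= CM /monoX big_cat; exact: mulrACA.
Qed.

End MonomialSpan.

(** * Empty fibres and the Nullstellensatz *)

(** The combinations in question form a differential ideal [J] whose zeros are the points of the
    fibre over y. If there are none, 1 is in the radical of [J], hence in [J]. *)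
Lemma regular_fiber_empty (Delta : finType) (Q : quasifieldType Delta) (n m : nat)
    (X : set (dspace Q n)) (Y : set (dspace Q m)) (phi : X -> Y) (y : Y) :
  diff_closed Q -> quasivariety X -> regular_map phi -> ~ range phi y ->
  exists L : seq ({dpoly Q[m]} * {dpoly Q[n]}),
    all (fun q => deval (set_val y) q.1 == 0%R) L /\
    forall x : X, (\sum_(q <- L) deval (set_val (phi x)) q.1 *
                   deval (set_val x) q.2 = 1)%R.
Proof.
move=> hQ [E XE] [p hp] ny.
pose J : set {dpoly Q[n]} := [set g | exists L : seq ({dpoly Q[m]} * {dpoly Q[n]}),
  all (fun q => deval (set_val y) q.1 == 0%R) L /\
  forall x : X, deval (set_val x) g = (\sum_(q <- L)
    deval (set_val (phi x)) q.1 * deval (set_val x) q.2)%R].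
have JI : diff_ideal J.
  split.
  - by exists [::]; split=> // x; rewrite big_nil raddf0.
  - move=> f g [L [L0 hL]] [L' [L0' hL']]; exists (L ++ L').
    by rewrite all_cat L0 L0'; split=> // x; rewrite devalD hL hL' big_cat.
  - move=> a f [L [L0 hL]]; exists [seq (q.1, a * q.2)%R | q <- L].
    rewrite all_map; split=> // x; rewrite devalM hL big_map mulr_sumr.
    by apply: eq_bigr => q _; rewrite devalM mulrCA.
  - move=> d f [L [L0 hL]].
    (* Leibniz rule; [der d q.1] still vanishes at y, as evaluation commutes with [der d]. *)
    exists ([seq (der d q.1, q.2) | q <- L] ++ [seq (q.1, der d q.2) | q <- L]).
    rewrite all_cat !all_map; split.
      rewrite L0 andbT; apply: sub_all L0 => q /eqP/= q0.
      by rewrite deval_der q0 der0.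
    move=> x; rewrite deval_der hL raddf_sum big_cat !big_map /= -big_split /=.
    by apply: eq_bigr => q _; rewrite !deval_der derM.
have noZ : zeros J = set0.
  rewrite -subset0 => x0 zx0; apply: ny.
  have Xx0 : X x0.
    (* The empty combination represents every polynomial vanishing on X. *)
    rewrite XE => f Ef; apply: zx0; exists [::]; split=> // x.
    by rewrite big_nil; have := set_valP x; rewrite {1}XE; exact.
  exists (SigSub (mem_set Xx0)) => //; apply: val_inj.
  have -> : val (phi (SigSub (mem_set Xx0))) = set_val (phi (SigSub (mem_set Xx0))) by [].
  rewrite hp; apply/ffunP => j; rewrite ffunE.
  apply/eqP; rewrite -subr_eq0; apply/eqP.
  have := zx0 (p j - dpolyC (val y j))%R; rewrite raddfB /= devalCst; apply.
  (* On X, [p j] minus the constant is the pullback of a coordinate difference vanishing at y. *)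
  exists [:: (dpolyX (j, mone) - dpolyC (val y j), 1)%R]; split.
    by rewrite /= raddfB /= devalCst devalX derop1 /= subrr eqxx.
  move=> x; rewrite big_seq1 /= !raddfB /= !devalCst devalX derop1 rmorph1 mulr1.
  by rewrite hp ffunE.
have : diff_rad J 1%R by rewrite (hQ _ _ JI) noZ.
move=> /(_ mone)[k]; rewrite derop1 expr1n => -[L [L0 hL]].
by exists L; split=> // x; rewrite -hL rmorph1.
Qed.

(** * Zariski topology of a subspace *)

Section ZariskiSubspace.
Context (Delta : finType) (Q : quasifieldType Delta) (m : nat).
Context (Y : set (dspace Q m)).

Lemma open_deval_neq0 (f : {dpoly Q[m]}) :
  open [set y : Y | deval (set_val y) f <> 0%R].
Proof.
have -> : [set y : Y | deval (set_val y) f <> 0%R] =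
    set_val @^-1` [set x : dspace Q m | deval x f <> 0%R] by [].
have /continuousP : continuous (set_val : Y -> dspace Q m).
  exact: initial_continuous.
apply; exists [set f]; apply/seteqP; split=> x.
  by move=> /contrapT fx _ ->.
by move=> /(_ f erefl) fx /=; apply.
Qed.

Lemma closed_deval_eq0 (f : {dpoly Q[m]}) :
  closed [set y : Y | deval (set_val y) f = 0%R].
Proof.
rewrite -openC; have -> : ~` [set y : Y | deval (set_val y) f = 0%R] =
  [set y : Y | deval (set_val y) f <> 0%R] by [].
exact: open_deval_neq0.
Qed.

Lemma dense_deval_eq0 (D : set Y) (f : {dpoly Q[m]}) : dense D ->
  (forall y, D y -> deval (set_val y) f = 0%R) ->
  forall y : Y, deval (set_val y) f = 0%R.
Proof.
move=> dD hD y; apply: contrapT => fy.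
have [|z [fz Dz]] := dD _ _ (open_deval_neq0 f); first by exists y.
exact: fz (hD z Dz).
Qed.

Lemma irreducible_dense_open (U : set Y) :
  irreducible_space (Y : Type) -> open U -> U !=set0 -> dense U.
Proof.
move=> [_ irr] oU [u Uu] V [v Vv] oV; apply: contrapT => VU0.
have [] := irr (~` V) (~` U).
- by rewrite closedC.
- by rewrite closedC.
- by rewrite -setCI -setC0; congr (~` _); apply: contrapT => /eqP/set0P.
- by move=> e; have : setT v by []; rewrite -e.
- by move=> e; have : setT u by []; rewrite -e.
Qed.

End ZariskiSubspace.

(** * The countable family of dense open sets *)

Theorem theorem30 (Delta : finType) (hDelta : (0 < #|Delta|)%N)
    (Q : quasifieldType Delta) (hQ : diff_closed Q) (n m : nat)
    (X : set (dspace Q n)) (Y : set (dspace Q m)) (phi : X -> Y)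
    (hX : quasivariety X) (hY : quasivariety Y)
    (hirr : irreducible_space (Y : Type))
    (hphi : regular_map phi) (hdense : dense (range phi)) :
  big_enough (range phi).
Proof.
have [p chp] := @quasifield_pchar _ Q.
pose chi (y : Y) : {rmorphism {dpoly Q[m]} -> Q} :=
  pFrobenius_aut chp \o deval (set_val y).
have chiE y f : chi y f = deval (set_val y) (f ^+ p)%R.
  by rewrite rmorphXn.
pose rho (x : X) := chi (phi x).
pose e (w : seq ('I_n * seq Delta)) (x : X) : Q :=
  pFrobenius_aut chp (deval (set_val x) (monoX Delta Q n w)).
pose N := [set r | forall x, rho x r = 0%R].
have NY r : N r -> forall y, chi y r = 0%R.
  move=> Nr y; rewrite chiE; apply: (dense_deval_eq0 _ _ _ _ _ _ hdense) => _ [x _ <-].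
  by rewrite -chiE; exact: Nr.
have N1 : ~ N 1%R.
  by have [[y _] _] := hirr => /NY/(_ y)/eqP; rewrite rmorph1 oner_eq0.
have Nprime r s : N (r * s)%R -> N r \/ N s.
  move=> /NY Nrs; have [_ irr] := hirr.
  have [|eA|eB] := irr _ _ (closed_deval_eq0 _ _ _ Y (r ^+ p)%R)
                           (closed_deval_eq0 _ _ _ Y (s ^+ p)%R).
  (* The loci of [r ^+ p] and [s ^+ p] cover Y, since nonzero p-th powers are not zero divisors. *)
  - apply/seteqP; split=> // y _; have := Nrs y.
    rewrite chiE exprMn devalM [X in (X * _)%R]rmorphXn => /= h.
    have [r0|s0] := quasifield_exp_pchar_integral _ _ _ _ _ chp h; last by right.
    by left; rewrite /= rmorphXn.
  - by left=> x; rewrite /rho chiE; have : setT (phi x) by []; rewrite -eA.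
  - by right=> x; rewrite /rho chiE; have : setT (phi x) by []; rewrite -eB.
(* [s] depends on [l] alone, not on y or the coefficients; this keeps the family countable. *)
have /choice[s hs] (l : seq (seq ('I_n * seq Delta))) : exists s : {dpoly Q[m]},
    ~ N s /\ forall (y : Y) (L : seq ({dpoly Q[m]} * seq ('I_n * seq Delta))),
      map snd L = l -> all (fun q => chi y q.1 == 0%R) L ->
      (forall x, 1 = \sum_(q <- L) rho x q.1 * e q.2 x)%R -> chi y s = 0%R.
  have [s Ns hs] := generic_independence _ _ Q _ _ rho e l N1 Nprime.
  exists s; split=> // y L Ll L0 hL.
  rewrite -[s]mulr1; apply: (hs _ _ L) => //; first by move=> r /NY.
  by move=> x; rewrite rmorph1.
exists (range (fun l => [set y : Y | deval (set_val y) (s l ^+ p)%R <> 0%R])); split.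
- exact: sub_countable (card_image_le _ _) (countableP _).
- move=> _ [l _ <-]; split; first exact: open_deval_neq0.
  apply: irreducible_dense_open => //; first exact: open_deval_neq0.
  have [Ns _] := hs l; apply: contrapT => h; apply: Ns => x.
  by rewrite /rho chiE; apply: contrapT => ?; apply: h; exists (phi x).
move=> y Uy; apply: contrapT => ny.
have [L [L0 hL]] := regular_fiber_empty _ _ _ _ _ _ _ _ hQ hX hphi ny.
(* Apply Frobenius and expand the factors on X into monomials; their constants are absorbed into the
   coefficients from Y, which remain zero at y. *)
have [M [M0 hM]] : exists M : seq ({dpoly Q[m]} * seq ('I_n * seq Delta)),
    all (fun q => chi y q.1 == 0%R) M /\ forall x,
    (pFrobenius_aut chp (\sum_(q <- L) deval (set_val (phi x)) q.1 *
       deval (set_val x) q.2) = \sum_(q <- M) rho x q.1 * e q.2 x)%R.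
  elim: (L) L0 => [|[u a] L' IH] /=.
    by exists [::]; split=> // x; rewrite !big_nil rmorph0.
  move=> /andP[/eqP u0 /IH[M [M0 hM]]].
  have [K ->] := dpoly_monoX_span _ _ _ a.
  exists ([seq (u * dpolyC q.1, q.2)%R | q <- K] ++ M).
  rewrite all_cat M0 andbT; split.
    by rewrite all_map; apply/allP => q _; rewrite /= rmorphM /= u0 mul0r rmorph0.
  move=> x; rewrite big_cons rmorphD /= hM big_cat big_map /=; congr (_ + _)%R.
  rewrite (raddf_sum (deval (set_val x))) mulr_sumr raddf_sum /=.
  apply: eq_bigr => q _.
  by rewrite !devalM mulrA !devalCst rmorphM.
apply: (Uy _ (imageT _ (map snd M))); rewrite -chiE.
have [_ hsM] := hs (map snd M); apply: (hsM y M) => // x.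
by rewrite -hM hL rmorph1.
Qed.
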